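(* Let $\mathscr{C}$ be a tensor representable (strict) monoidal category with right and left tensor dualising functors $R, L\colon \mathscr{C}^{\mathrm{op}}\to\mathscr{C}$. Then $R\colon \mathscr{C}^{\mathrm{op}}\to\mathscr{C}$ is right adjoint to $L^{\mathrm{op}}\colon \mathscr{C}\to\mathscr{C}^{\mathrm{op}}$. Further, $R$ is an equivalence of categories if and only if for all $x\in\mathscr{C}$ the canonical morphisms $$x \xrightarrow{\,u_x^{(Rx)}\,} x\otimes Rx\otimes LRx \xrightarrow{\,\varepsilon_1^{(x)}\otimes LRx\,} LRx \qquad\text{and}\qquad x \xrightarrow{\,\eta_x^{(Lx)}\,} RLx\otimes Lx\otimes x \xrightarrow{\,RLx\otimes c_1^{(x)}\,} RLx$$ are invertible. In this case $L^{\mathrm{op}}$ is a quasi-inverse of $R$.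
   Context: Monoidal categories are taken to be strict, with unit $1$. A monoidal category $\mathscr{C}$ is right tensor representable if for every $x\in\mathscr{C}$ there is an object $Rx\in\mathscr{C}$ such that $x\otimes -$ is left adjoint to $Rx\otimes -$; it is left tensor representable if for every $x$ there is an object $Lx$ such that $-\otimes x$ is left adjoint to $-\otimes Lx$; it is tensor representable if it is both. A tensor representable category is closed monoidal, with $[x,-]_r\cong Rx\otimes -$ (right adjoint of $x\otimes -$) and $[x,-]_\ell\cong -\otimes Lx$ (right adjoint of $-\otimes x$). The assignments $x\mapsto Rx$ and $x\mapsto Lx$ extend to functors $R=[-,1]_r$ and $L=[-,1]_\ell\colon \mathscr{C}^{\mathrm{op}}\to\mathscr{C}$, the right and left tensor dualising functors; so $\mathscr{C}(x\otimes y,1)\cong\mathscr{C}(y,Rx)$ and $\mathscr{C}(y\otimes x,1)\cong\mathscr{C}(y,Lx)$ naturally. The units and counits of the adjunctions are denoted $\eta_y^{(x)}\colon y\to Rx\otimes x\otimes y$, $\varepsilon_y^{(x)}\colon x\otimes Rx\otimes y\to y$ (for $x\otimes-\dashv Rx\otimes-$), and $u_y^{(x)}\colon y\to y\otimes x\otimes Lx$, $c_y^{(x)}\colon y\otimes Lx\otimes x\to y$ (for $-\otimes x\dashv -\otimes Lx$). *)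

(* Defs.v *)
From Corelib Require Import ssreflect ssrfun.

Set Implicit Arguments.
Unset Strict Implicit.
Unset Printing Implicit Defensive.

Declare Scope cat_scope.
Delimit Scope cat_scope with cat.
Local Open Scope cat_scope.

Reserved Notation "g ∘ f" (at level 40, left associativity).
Reserved Notation "x ⊗ y" (at level 35, right associativity).
Reserved Notation "f ⊠ g" (at level 35, right associativity).

Record category := Category {
  ob :> Type;
  hom : ob -> ob -> Type;
  idm : forall x, hom x x;
  comp : forall x y z, hom y z -> hom x y -> hom x z;
  comp_idl : forall x y (f : hom x y), comp (idm y) f = f;
  comp_idr : forall x y (f : hom x y), comp f (idm x) = f;
  comp_assoc : forall x y z t (h : hom z t) (g : hom y z) (f : hom x y),
    comp h (comp g f) = comp (comp h g) f }.

Arguments hom {c} x y : rename.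
Arguments idm {c} x : rename.
Arguments comp {c x y z} g f : rename.

Notation "g ∘ f" := (comp g f) : cat_scope.

Definition is_iso (C : category) (x y : C) (f : hom x y) : Prop :=
  exists g : hom y x, g ∘ f = idm x /\ f ∘ g = idm y.

Definition op (C : category) : category :=
  @Category (ob C) (fun x y => @hom C y x) (fun x => @idm C x)
    (fun x y z g f => @comp C z y x f g)
    (fun x y f => comp_idr f) (fun x y f => comp_idl f)
    (fun x y z t h g f => esym (comp_assoc f g h)).

Record functor (C D : category) := Functor {
  fob :> C -> D;
  fmap : forall x y, hom x y -> hom (fob x) (fob y);
  fmap_id : forall x, fmap (idm x) = idm (fob x);
  fmap_comp : forall x y z (g : hom y z) (f : hom x y),
    fmap (g ∘ f) = fmap g ∘ fmap f }.

Arguments fmap {C D} F {x y} f : rename.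

Definition id_functor (C : category) : functor C C :=
  @Functor C C (fun x => x) (fun x y f => f)
    (fun x => erefl) (fun x y z g f => erefl).

Definition comp_functor (C D E : category) (G : functor D E) (F : functor C D) :
  functor C E.
Proof.
refine (@Functor C E (fun x => G (F x)) (fun x y f => fmap G (fmap F f)) _ _).
- by move=> x; rewrite !fmap_id.
- by move=> x y z g f; rewrite !fmap_comp.
Defined.

(* F^op, for a contravariant F : C^op -> D, taken directly as a functor
   C -> D^op rather than (C^op)^op -> D^op *)
Definition op_functor (C D : category) (F : functor (op C) D) :
  functor C (op D) :=
  @Functor C (op D) (fun x => F x) (fun x y f => @fmap _ _ F y x f)
    (fun x => @fmap_id _ _ F x)
    (fun x y z g f => @fmap_comp _ _ F z y x f g).

Record nat_trans (C D : category) (F G : functor C D) := NatTrans {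
  component :> forall x, hom (F x) (G x);
  naturality : forall x y (f : hom x y),
    component y ∘ fmap F f = fmap G f ∘ component x }.

Definition naturally_isomorphic (C D : category) (F G : functor C D) : Prop :=
  exists a : nat_trans F G, forall x, is_iso (a x).

Definition quasi_inverse (C D : category) (F : functor C D) (G : functor D C) :
    Prop :=
  naturally_isomorphic (id_functor C) (comp_functor G F) /\
  naturally_isomorphic (comp_functor F G) (id_functor D).

Definition is_equivalence (C D : category) (F : functor C D) : Prop :=
  exists G : functor D C, quasi_inverse F G.

(* [adjunction F G] is the structure of F being left adjoint to G *)

Record adjunction (C D : category) (F : functor C D) (G : functor D C) :=
  Adjunction {
    adj_unit : nat_trans (id_functor C) (comp_functor G F);
    adj_counit : nat_trans (comp_functor F G) (id_functor D);
    triangle_l : forall x : C, adj_counit (F x) ∘ fmap F (adj_unit x) = idm (F x);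
    triangle_r : forall y : D, fmap G (adj_counit y) ∘ adj_unit (G y) = idm (G y) }.

Definition transpose (C D : category) (F : functor C D) (G : functor D C)
    (A : adjunction F G) (x : C) (y : D) (f : hom (F x) y) : hom x (G y) :=
  fmap G f ∘ adj_unit A x.

Lemma transposeK (C D : category) (F : functor C D) (G : functor D C)
    (A : adjunction F G) (x : C) (y : D) (f : hom (F x) y) :
  adj_counit A y ∘ fmap F (transpose A f) = f.
Proof.
rewrite /transpose fmap_comp comp_assoc.
have /= -> := naturality (adj_counit A) f.
by rewrite -comp_assoc triangle_l comp_idr.
Qed.

Lemma transpose_counit (C D : category) (F : functor C D) (G : functor D C)
    (A : adjunction F G) (x : C) (y : D) (g : hom x (G y)) :
  transpose A (adj_counit A y ∘ fmap F g) = g.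
Proof.
rewrite /transpose fmap_comp -comp_assoc.
have /= <- := naturality (adj_unit A) g.
by rewrite comp_assoc triangle_r comp_idl.
Qed.

Definition eqhom (C : category) (x y : C) (e : x = y) : hom x y :=
  match e in _ = z return hom x z with erefl => idm x end.

(* The tensor product is strictly associative and unital on objects. On
   morphisms the two sides of each law have equal, but not convertible, sources
   and targets, so the equality of morphisms is stated modulo the morphisms
   [eqhom e], which are identities up to the equality e of objects. *)
Record strict_monoidal_category := StrictMonoidalCategory {
  underlying :> category;
  tens : underlying -> underlying -> underlying;
  tens_hom : forall x x' y y' : underlying,
    hom x x' -> hom y y' -> hom (tens x y) (tens x' y');
  tens_id : forall x y, tens_hom (idm x) (idm y) = idm (tens x y);
  tens_comp : forall x x' x'' y y' y''
    (f' : hom x' x'') (f : hom x x') (g' : hom y' y'') (g : hom y y'),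
    tens_hom (f' ∘ f) (g' ∘ g) = tens_hom f' g' ∘ tens_hom f g;
  one : underlying;
  tensA : forall x y z, tens x (tens y z) = tens (tens x y) z;
  tens1l : forall x, tens one x = x;
  tens1r : forall x, tens x one = x;
  tens_homA : forall x x' y y' z z'
    (f : hom x x') (g : hom y y') (h : hom z z'),
    eqhom (tensA x' y' z') ∘ tens_hom f (tens_hom g h) =
    tens_hom (tens_hom f g) h ∘ eqhom (tensA x y z);
  tens_hom1l : forall x x' (f : hom x x'),
    eqhom (tens1l x') ∘ tens_hom (idm one) f = f ∘ eqhom (tens1l x);
  tens_hom1r : forall x x' (f : hom x x'),
    eqhom (tens1r x') ∘ tens_hom f (idm one) = f ∘ eqhom (tens1r x) }.

Arguments one {s}.
Notation "x ⊗ y" := (tens x y) : cat_scope.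
Notation "f ⊠ g" := (tens_hom f g) : cat_scope.

Section Tensoring.
Variable C : strict_monoidal_category.

Definition tensl (x : C) : functor C C.
Proof.
refine (@Functor C C (fun y => x ⊗ y) (fun y z f => idm x ⊠ f) _ _).
- by move=> y; rewrite tens_id.
- by move=> y z t g f; rewrite -tens_comp comp_idl.
Defined.

Definition tensr (x : C) : functor C C.
Proof.
refine (@Functor C C (fun y => y ⊗ x) (fun y z f => f ⊠ idm x) _ _).
- by move=> y; rewrite tens_id.
- by move=> y z t g f; rewrite -tens_comp comp_idl.
Defined.

Lemma eqhomK (x y : C) (e : x = y) : eqhom (esym e) ∘ eqhom e = idm x.
Proof. by case: y / e; rewrite /= comp_idl. Qed.

Lemma eqhomVK (x y : C) (e : x = y) : eqhom e ∘ eqhom (esym e) = idm y.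
Proof. by case: y / e; rewrite /= comp_idl. Qed.

Lemma tens_interchange (x x' y y' : C) (f : hom x x') (g : hom y y') :
  (f ⊠ idm y') ∘ (idm x ⊠ g) = (idm x' ⊠ g) ∘ (f ⊠ idm y).
Proof. by rewrite -!tens_comp !comp_idl !comp_idr. Qed.

End Tensoring.

Record right_tensor_representation (C : strict_monoidal_category) := {
  rdual : C -> C;
  radj : forall x : C, adjunction (tensl x) (tensl (rdual x)) }.

Record left_tensor_representation (C : strict_monoidal_category) := {
  ldual : C -> C;
  ladj : forall x : C, adjunction (tensr x) (tensr (ldual x)) }.

Record tensor_representation (C : strict_monoidal_category) := {
  right_rep :> right_tensor_representation C;
  left_rep :> left_tensor_representation C }.

Section RightDualising.
Variables (C : strict_monoidal_category) (T : right_tensor_representation C).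

(* ε_1^{(x)}, using x ⊗ Rx = x ⊗ (Rx ⊗ 1) *)
Definition rev (x : C) : hom (x ⊗ rdual T x) one :=
  adj_counit (radj T x) one ∘ (idm x ⊠ eqhom (esym (tens1r (rdual T x)))).

(* the isomorphism C(x ⊗ y, 1) -> C(y, Rx) of the adjunction, using Rx ⊗ 1 = Rx *)
Definition rcurry (x y : C) (f : hom (x ⊗ y) one) : hom y (rdual T x) :=
  eqhom (tens1r (rdual T x)) ∘ @transpose _ _ _ _ (radj T x) y one f.

Lemma rcurryK (x y : C) (f : hom (x ⊗ y) one) :
  rev x ∘ (idm x ⊠ rcurry f) = f.
Proof.
rewrite /rev /rcurry -comp_assoc -tens_comp comp_idl comp_assoc eqhomK comp_idl.
exact: (transposeK (radj T x) f).
Qed.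

Lemma rcurry_rev (x y : C) (g : hom y (rdual T x)) :
  rcurry (rev x ∘ (idm x ⊠ g)) = g.
Proof.
rewrite /rev /rcurry -comp_assoc -tens_comp comp_idl.
have /= -> := transpose_counit (radj T x)
  (eqhom (esym (tens1r (rdual T x))) ∘ g : hom y (tensl (rdual T x) one)).
by rewrite comp_assoc eqhomVK comp_idl.
Qed.

(* R f is the action of [-, 1]_r on f: the transpose of ε_1^{(y)} ∘ (f ⊗ Ry) *)
Definition rdual_map (x y : C) (f : hom x y) : hom (rdual T y) (rdual T x) :=
  rcurry (rev y ∘ (f ⊠ idm (rdual T y))).

Lemma rdual_map_id (x : C) : rdual_map (idm x) = idm (rdual T x).
Proof. exact: rcurry_rev. Qed.

Lemma rdual_map_comp (x y z : C) (g : hom y z) (f : hom x y) :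
  rdual_map (g ∘ f) = rdual_map f ∘ rdual_map g.
Proof.
rewrite -[RHS]rcurry_rev {1}/rdual_map; congr rcurry.
rewrite -(comp_idl (idm x)) tens_comp comp_assoc rcurryK.
rewrite -comp_assoc tens_interchange comp_assoc rcurryK.
by rewrite -comp_assoc -tens_comp comp_idl.
Qed.

Definition Rfun : functor (op C) C :=
  @Functor (op C) C (rdual T) (fun x y f => rdual_map f)
    rdual_map_id (fun x y z g f => rdual_map_comp f g).

End RightDualising.

Section LeftDualising.
Variables (C : strict_monoidal_category) (T : left_tensor_representation C).

(* c_1^{(x)}, using Lx ⊗ x = (1 ⊗ Lx) ⊗ x *)
Definition lev (x : C) : hom (ldual T x ⊗ x) one :=
  adj_counit (ladj T x) one ∘ (eqhom (esym (tens1l (ldual T x))) ⊠ idm x).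

(* the isomorphism C(y ⊗ x, 1) -> C(y, Lx) of the adjunction, using 1 ⊗ Lx = Lx *)
Definition lcurry (x y : C) (f : hom (y ⊗ x) one) : hom y (ldual T x) :=
  eqhom (tens1l (ldual T x)) ∘ @transpose _ _ _ _ (ladj T x) y one f.

Lemma lcurryK (x y : C) (f : hom (y ⊗ x) one) :
  lev x ∘ (lcurry f ⊠ idm x) = f.
Proof.
rewrite /lev /lcurry -comp_assoc -tens_comp comp_idl comp_assoc eqhomK comp_idl.
exact: (transposeK (ladj T x) f).
Qed.

Lemma lcurry_lev (x y : C) (g : hom y (ldual T x)) :
  lcurry (lev x ∘ (g ⊠ idm x)) = g.
Proof.
rewrite /lev /lcurry -comp_assoc -tens_comp comp_idl.
have /= -> := transpose_counit (ladj T x)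
  (eqhom (esym (tens1l (ldual T x))) ∘ g : hom y (tensr (ldual T x) one)).
by rewrite comp_assoc eqhomVK comp_idl.
Qed.

(* L f is the action of [-, 1]_ℓ on f: the transpose of c_1^{(y)} ∘ (Ly ⊗ f) *)
Definition ldual_map (x y : C) (f : hom x y) : hom (ldual T y) (ldual T x) :=
  lcurry (lev y ∘ (idm (ldual T y) ⊠ f)).

Lemma ldual_map_id (x : C) : ldual_map (idm x) = idm (ldual T x).
Proof. exact: lcurry_lev. Qed.

Lemma ldual_map_comp (x y z : C) (g : hom y z) (f : hom x y) :
  ldual_map (g ∘ f) = ldual_map f ∘ ldual_map g.
Proof.
rewrite -[RHS]lcurry_lev {1}/ldual_map; congr lcurry.
rewrite -(comp_idl (idm x)) tens_comp comp_assoc lcurryK.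
rewrite -comp_assoc -tens_interchange comp_assoc lcurryK.
by rewrite -comp_assoc -tens_comp comp_idl.
Qed.

Definition Lfun : functor (op C) C :=
  @Functor (op C) C (ldual T) (fun x y f => ldual_map f)
    ldual_map_id (fun x y z g f => ldual_map_comp f g).

End LeftDualising.

Section Canonical.
Variables (C : strict_monoidal_category) (T : tensor_representation C).

Local Notation R := (Rfun T).
Local Notation L := (Lfun T).

(* x --u--> (x ⊗ Rx) ⊗ LRx --ε_1 ⊗ LRx--> 1 ⊗ LRx = LRx *)
Definition canonical_LR (x : C) : hom x (L (R x)) :=
  eqhom (tens1l (L (R x))) ∘
  ((rev T x ⊠ idm (L (R x))) ∘ adj_unit (ladj T (R x)) x).

(* x --η--> RLx ⊗ (Lx ⊗ x) --RLx ⊗ c_1--> RLx ⊗ 1 = RLx *)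
Definition canonical_RL (x : C) : hom x (R (L x)) :=
  eqhom (tens1r (R (L x))) ∘
  ((idm (R (L x)) ⊠ lev T x) ∘ adj_unit (radj T (L x)) x).

End Canonical.

(* Main.v *)
From Corelib Require Import ssreflect ssrfun.
From Stdlib Require Import IndefiniteDescription.
Require Import Defs.

(** A morphism [y -> Rx] is the same thing as a pairing [x ⊗ y -> 1], and a
    morphism [x -> Ly] is also the same thing as a pairing [x ⊗ y -> 1].  Hence
    [C(y, Rx)] and [C(x, Ly)] are in natural bijection, which says that [L^op] is
    left adjoint to [R].  The unit of this adjunction at [x] corresponds to the
    evaluation pairing [Lx ⊗ x -> 1] and the counit to [x ⊗ Rx -> 1]; unfolding
    the bijections, these are the two canonical morphisms [x -> RLx] and
    [x -> LRx].  Because transposition is natural in both arguments ([rcurry_comp],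
    [rdual_map_rcurry]), naturality of the unit and of the counit reduces to the
    dinaturality of the evaluations ([rev_dinatural], [lev_dinatural]), and the
    triangle identities say that transposing twice changes nothing.

    The rest holds for every adjunction [F ⊣ G]: the right adjoint [G] is an
    equivalence if and only if the unit and the counit are invertible.  If they
    are, then they exhibit [F] as a quasi-inverse of [G]
    ([adjunction_quasi_inverse]).  Conversely, an equivalence is full and
    faithful, so the unit at [G y] is [G g] for some [g], and [g] is inverse to
    the counit ([equivalence_adj_counit_iso]).  Then the unit is invertible at
    the objects [G y], hence at every object, because [G] is essentially
    surjective ([equivalence_adj_unit_iso]). *)

Set Implicit Arguments.
Unset Strict Implicit.
Unset Printing Implicit Defensive.

Local Open Scope cat_scope.

(** * Isomorphisms and equivalences of categories *)

Section Isomorphisms.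
Variable C : category.

Lemma is_iso_op (x y : C) (f : hom x y) :
  @is_iso (op C) y x f <-> is_iso f.
Proof. by split=> -[g [h1 h2]]; exists g. Qed.

Lemma is_iso_comp (x y z : C) (g : hom y z) (f : hom x y) :
  is_iso g -> is_iso f -> is_iso (g ∘ f).
Proof.
move=> [g' [gK g'K]] [f' [fK f'K]]; exists (f' ∘ g'); split.
- by rewrite comp_assoc -(comp_assoc f') gK comp_idr.
- by rewrite comp_assoc -(comp_assoc g) f'K comp_idr.
Qed.

Lemma is_iso_cancel_l (x y z : C) (g : hom y z) (f : hom x y) :
  is_iso g -> is_iso (g ∘ f) -> is_iso f.
Proof.
move=> [g' [gK g'K]] gf_iso; rewrite -(comp_idl f) -gK -comp_assoc.
by apply: is_iso_comp => //; exists g.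
Qed.

Lemma is_iso_fmap (D : category) (F : functor C D) (x y : C) (f : hom x y) :
  is_iso f -> is_iso (fmap F f).
Proof.
by move=> [g [fK gK]]; exists (fmap F g); rewrite -!fmap_comp fK gK !fmap_id.
Qed.

End Isomorphisms.

Lemma naturally_isomorphic_sym (C D : category) (F G : functor C D) :
  naturally_isomorphic F G -> naturally_isomorphic G F.
Proof.
move=> [a a_iso].
(* The inverse transformation is data, so the inverses, which merely exist at
   each object, have to be chosen. *)
pose inv x := proj1_sig (constructive_indefinite_description _ (a_iso x)).
have aK x : inv x ∘ a x = idm (F x).
  by rewrite /inv; case: constructive_indefinite_description => g [].
have invK x : a x ∘ inv x = idm (G x).
  by rewrite /inv; case: constructive_indefinite_description => g [].
have inv_nat x y (f : hom x y) : inv y ∘ fmap G f = fmap F f ∘ inv x.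
  rewrite -[LHS]comp_idr -(invK x) comp_assoc -(comp_assoc (inv y)).
  by rewrite -naturality comp_assoc aK comp_idl.
by exists (NatTrans inv_nat) => x; exists (a x).
Qed.

Lemma left_inverse_faithful (C D : category) (G : functor D C) (H : functor C D) :
  naturally_isomorphic (id_functor D) (comp_functor H G) ->
  forall x y (f g : hom x y), fmap G f = fmap G g -> f = g.
Proof.
move=> [a a_iso] x y f g Gfg; have [b [aK _]] := a_iso y.
have /= af := naturality a f; have /= ag := naturality a g.
move: af; rewrite Gfg -ag => /(congr1 (comp b)).
by rewrite !comp_assoc aK !comp_idl.
Qed.

(** Conjugating [H h] by the isomorphisms [x ≅ HGx] gives a morphism [f] with
    [HGf = Hh]; the functor [H] is itself faithful, so [f] is a preimage
    of [h]. *)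
Lemma quasi_inverse_full (C D : category) (G : functor D C) (H : functor C D) :
  quasi_inverse G H ->
  forall x y (h : hom (G x) (G y)), exists f, fmap G f = h.
Proof.
move=> [[a a_iso] /naturally_isomorphic_sym GH] x y h.
have [b [aK bK]] := a_iso y; have [b' [aK' bK']] := a_iso x.
exists (b ∘ fmap H h ∘ a x); apply: (left_inverse_faithful GH).
have /= a_nat := naturality a (b ∘ fmap H h ∘ a x).
rewrite -[LHS]comp_idr -bK' comp_assoc -a_nat !comp_assoc bK comp_idl.
by rewrite -comp_assoc bK' comp_idr.
Qed.

(** * Adjunctions whose right adjoint is an equivalence *)

Section AdjointEquivalence.
Variables (C D : category) (F : functor C D) (G : functor D C).
Variable A : adjunction F G.

Lemma adjunction_quasi_inverse :
  (forall x, is_iso (adj_unit A x)) -> (forall y, is_iso (adj_counit A y)) ->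
  quasi_inverse G F.
Proof.
move=> unit_iso counit_iso; split; apply: naturally_isomorphic_sym.
- by exists (adj_counit A).
- by exists (adj_unit A).
Qed.

(** Fullness of [G] provides the inverse of the counit as a preimage of the
    unit at [G y]; one of the two equations follows from a triangle identity
    by faithfulness, the other by comparing transposes. *)
Lemma equivalence_adj_counit_iso :
  is_equivalence G -> forall y, is_iso (adj_counit A y).
Proof.
move=> [H GH] y; have [g Gg] := quasi_inverse_full GH (adj_unit A (G y)).
exists g; split.
- rewrite -[LHS](transposeK A) -[RHS](transposeK A) /transpose; congr (_ ∘ fmap F _).
  by rewrite fmap_comp -comp_assoc triangle_r Gg comp_idr fmap_id comp_idl.
- apply: (left_inverse_faithful (proj1 GH)).
  by rewrite fmap_comp Gg triangle_r fmap_id.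
Qed.

Lemma equivalence_adj_unit_iso :
  is_equivalence G -> forall x, is_iso (adj_unit A x).
Proof.
move=> equivG x.
have unitG_iso y : is_iso (adj_unit A (G y)).
  apply: (is_iso_cancel_l (is_iso_fmap G (equivalence_adj_counit_iso equivG y))).
  by rewrite triangle_r; exists (idm (G y)); rewrite comp_idl.
have [H [_ /naturally_isomorphic_sym[b b_iso]]] := equivG.
(* The unit is transported from [G (H x)] to [x] along [b x : x ≅ G (H x)]. *)
have /= unit_nat := naturality (adj_unit A) (b x).
apply: (is_iso_cancel_l (is_iso_fmap G (is_iso_fmap F (b_iso x)))).
by rewrite -unit_nat; exact: (is_iso_comp (unitG_iso _) (b_iso x)).
Qed.

End AdjointEquivalence.

(** * The dualising functors in terms of pairings *)

Section Pairings.
Variables (C : strict_monoidal_category) (T : tensor_representation C).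

Local Notation R := (Rfun T).
Local Notation L := (Lfun T).

(** The bijection between pairings [x ⊗ y -> 1] and morphisms [y -> Rx] is natural
    in [y]; by [rdual_map_rcurry] it is natural in [x] too, and [lcurry_comp] and
    [ldual_map_lcurry] are the same facts for [L]. *)
Lemma rcurry_comp (x y z : C) (f : hom (x ⊗ y) one) (g : hom z y) :
  rcurry T f ∘ g = rcurry T (f ∘ (idm x ⊠ g)).
Proof.
rewrite -[LHS]rcurry_rev; congr rcurry.
by rewrite -(comp_idl (idm x)) tens_comp comp_assoc rcurryK comp_idl.
Qed.

Lemma rdual_map_rcurry (x x' y : C) (h : hom x x') (f : hom (x' ⊗ y) one) :
  rdual_map T h ∘ rcurry T f = rcurry T (f ∘ (h ⊠ idm y)).
Proof.
rewrite rcurry_comp; congr rcurry.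
by rewrite -comp_assoc tens_interchange comp_assoc rcurryK.
Qed.

Lemma lcurry_comp (x y z : C) (f : hom (y ⊗ x) one) (g : hom z y) :
  lcurry T f ∘ g = lcurry T (f ∘ (g ⊠ idm x)).
Proof.
rewrite -[LHS]lcurry_lev; congr lcurry.
by rewrite -(comp_idl (idm x)) tens_comp comp_assoc lcurryK comp_idl.
Qed.

Lemma ldual_map_lcurry (x x' y : C) (h : hom x x') (f : hom (y ⊗ x') one) :
  ldual_map T h ∘ lcurry T f = lcurry T (f ∘ (idm y ⊠ h)).
Proof.
rewrite lcurry_comp; congr lcurry.
by rewrite -comp_assoc -tens_interchange comp_assoc lcurryK.
Qed.

(** Both dinaturality laws are the definition of the dual of a morphism as a
    transpose. *)
Lemma rev_dinatural (x y : C) (f : hom x y) :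
  rev T x ∘ (idm x ⊠ rdual_map T f) = rev T y ∘ (f ⊠ idm (rdual T y)).
Proof. exact: rcurryK. Qed.

Lemma lev_dinatural (x y : C) (f : hom x y) :
  lev T x ∘ (ldual_map T f ⊠ idm x) = lev T y ∘ (idm (ldual T y) ⊠ f).
Proof. exact: lcurryK. Qed.

(** * The adjunction between the dualising functors *)

Lemma rcurry_lev_natural (x y : C) (f : hom x y) :
  rcurry T (lev T y) ∘ f = rdual_map T (ldual_map T f) ∘ rcurry T (lev T x).
Proof. by rewrite rcurry_comp rdual_map_rcurry lev_dinatural. Qed.

Lemma lcurry_rev_natural (x y : C) (f : hom x y) :
  lcurry T (rev T y) ∘ f = ldual_map T (rdual_map T f) ∘ lcurry T (rev T x).
Proof. by rewrite lcurry_comp ldual_map_lcurry rev_dinatural. Qed.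

(** The composite is the transpose of the pairing
    [Lx ⊗ x -> Lx ⊗ RLx -> 1], which is the evaluation [lev x]. *)
Lemma dualising_triangle_L (x : C) :
  ldual_map T (rcurry T (lev T x)) ∘ lcurry T (rev T (ldual T x)) =
  idm (ldual T x).
Proof.
by rewrite ldual_map_lcurry rcurryK -[RHS]lcurry_lev tens_id comp_idr.
Qed.

Lemma dualising_triangle_R (x : C) :
  rdual_map T (lcurry T (rev T x)) ∘ rcurry T (lev T (rdual T x)) =
  idm (rdual T x).
Proof.
by rewrite rdual_map_rcurry lcurryK -[RHS]rcurry_rev tens_id comp_idr.
Qed.

(** The transpose of the evaluation [Lx ⊗ x -> 1] unfolds to the canonical
    morphism [x -> RLx], by the definition of [rcurry]. *)
Definition dualising_unit :
  nat_trans (id_functor C) (comp_functor R (op_functor L)) :=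
  @NatTrans _ _ (id_functor C) (comp_functor R (op_functor L))
    (canonical_RL T) rcurry_lev_natural.

(** The components point from [LRx] to [x] in [op C], and composition there is
    reversed, so this is the naturality square of [x -> LRx] read backwards. *)
Definition dualising_counit :
  nat_trans (comp_functor (op_functor L) R) (id_functor (op C)) :=
  @NatTrans _ _ (comp_functor (op_functor L) R) (id_functor (op C))
    (canonical_LR T) (fun x y f => esym (@lcurry_rev_natural y x f)).

Definition dualising_adjunction : adjunction (op_functor L) R :=
  @Adjunction _ _ (op_functor L) R dualising_unit dualising_counit
    dualising_triangle_L dualising_triangle_R.

End Pairings.

Theorem proposition3p7
    (C : strict_monoidal_category) (T : tensor_representation C) :
  inhabited (adjunction (op_functor (Lfun T)) (Rfun T)) /\
  (is_equivalence (Rfun T) <->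
    forall x : C, is_iso (canonical_LR T x) /\ is_iso (canonical_RL T x)) /\
  (is_equivalence (Rfun T) ->
    quasi_inverse (Rfun T) (op_functor (Lfun T))).
Proof.
have canon_quasi_inverse : (forall x : C, is_iso (canonical_LR T x) /\
    is_iso (canonical_RL T x)) -> quasi_inverse (Rfun T) (op_functor (Lfun T)).
{ move=> canon; apply: (adjunction_quasi_inverse (A := dualising_adjunction T)).
  - by move=> x; case: (canon x).
  - by move=> x; apply/is_iso_op; case: (canon x). }
have equiv_canon : is_equivalence (Rfun T) -> forall x : C,
    is_iso (canonical_LR T x) /\ is_iso (canonical_RL T x).
{ move=> equivR x; split.
  - exact/is_iso_op/(equivalence_adj_counit_iso (dualising_adjunction T) equivR x).
  - exact: (equivalence_adj_unit_iso (dualising_adjunction T) equivR x). }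
split; first exact: (inhabits (dualising_adjunction T)).
split; last by move=> /equiv_canon/canon_quasi_inverse.
by split=> // /canon_quasi_inverse; exists (op_functor (Lfun T)).
Qed.
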